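(* Let $\mathbb F_q$ be a finite field with $q$ elements, let $n\ge 2$, let $a_1,\dots,a_n,b\in\mathbb F_q^*$, and let $m_1,\dots,m_n,k,k_1,\dots,k_n$ be positive integers. Put $M=\operatorname{lcm}[m_1,\dots,m_n]$ and $d_j=\gcd(m_j,q-1)$ for $j=1,\dots,n$. Let $0\le t\le n$ and assume (after indexing) that $d_1,\dots,d_t$ are odd, $d_{t+1},\dots,d_n$ are even, and $d_1,\dots,d_t,d_{t+1}/2,\dots,d_n/2$ are pairwise coprime. Assume also that $$\gcd\Bigl(\sum_{j=1}^n \frac{k_jM}{m_j}-kM,\;q-1\Bigr)=1.$$ Then the number of $(x_1,\dots,x_n)\in\mathbb F_q^n$ satisfying $(a_1x_1^{m_1}+\dots+a_nx_n^{m_n})^k=bx_1^{k_1}\cdots x_n^{k_n}$ equals $$q^{n-1}+(-1)^{n-1}+(-1)^{n-1}\sum_{j=1}^{\lfloor (n-t)/2\rfloor}\eta((-1)^j)\,\sigma_{2j}\bigl(\eta(a_{t+1}),\dots,\eta(a_n)\bigr)\,q^j+E,$$ where $E=\eta((-1)^{n/2}a_1\cdots a_n)\,q^{(n-2)/2}(q-1)$ if $t=0$ and $n$ is even, and $E=0$ otherwise.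
   Context: $\sigma_{2j}(z_1,\dots,z_{n-t})$ denotes the elementary symmetric polynomial of degree $2j$ in $n-t$ variables. $\eta$ is the quadratic character on $\mathbb F_q$: $\eta(x)=+1,-1,0$ according as $x$ is a nonzero square, a non-square, or zero in $\mathbb F_q$. (If $q$ is even then every $d_j$ is odd, so $t=n$ and all terms involving $\eta$ are absent.) $\mathbb F_q^*=\mathbb F_q\setminus\{0\}$. *)

(* Defs.v *)
From HB Require Import structures.
From mathcomp Require Import all_boot all_order all_algebra all_field.
Set Implicit Arguments. Unset Strict Implicit. Unset Printing Implicit Defensive.
Import Order.TTheory GRing.Theory Num.Theory.
Local Open Scope ring_scope.

Definition qeta (F : finFieldType) (x : F) : int :=
  if x == 0 then 0
  else if [exists y : F, y ^+ 2 == x] then 1 else -1.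

Definition esym_at (n : nat) (P : {pred 'I_n}) (f : 'I_n -> int) (r : nat) : int :=
  \sum_(I : {set 'I_n} | (I \subset P) && (#|I| == r)) \prod_(i in I) f i.

(* Main.v *)
Require Import Defs.
From HB Require Import structures.
From mathcomp Require Import all_boot all_order all_algebra all_field.
From mathcomp Require Import ring zify.
Set Implicit Arguments.
Unset Strict Implicit.
Unset Printing Implicit Defensive.
Import Order.TTheory GRing.Theory Num.Theory.
Local Open Scope ring_scope.

(** The number of zeros of S(x) = a_1 x_1^(d_1) + ... + a_n x_n^(d_n) with all
x_i in D, where D is F or F^x, is the coefficient at 0, in the group algebra
Z[F] of (F, +), of the product over i of the sum_(x in D) [a_i x^(d_i)].

Multiplying all the a_i by the same element of F^x preserves the zeros.  If d_i
divides s_j for all i <> j, averaging over the multipliers prod_i y_i^(s_i) with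
y in (F^x)^n thus replaces each d_i by gcd(d_i, s_i), which brings all exponents
down to 1 or 2.  The factors then lie in the subring generated by the norm
element N = sum_x [x] and the Gauss element G = sum_x eta(x) [x], in which
N^2 = q N, N G = 0 and G^2 = eta(-1) (q - N), so their product can be expanded.

If some x_j vanishes, then x is a solution if and only if S(x) = 0.  If none
does, then S(x) <> 0 for every solution x, and c in F^x acts on such x by
x_j |-> c^(M/m_j) x_j, which multiplies the quotient of the two sides by
c^(A - kM) with A the sum of the k_j M/m_j; since A - kM is prime to q - 1,
exactly one c turns a given x with S(x) <> 0 into a solution. *)

(* The functions of type {ffun G -> R} already have a ring structure, with the
   pointwise product. *)
Definition group_algebra (R : comPzRingType) (G : finZmodType) : Type :=
  {ffun G -> R}.

Section GroupAlgebra.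

Variables (R : comPzRingType) (G : finZmodType).
Local Notation "R[G]" := (group_algebra R G).
Implicit Types (f g h : R[G]) (u v w : G).

HB.instance Definition _ := GRing.Zmodule.on R[G].

Definition dirac u : R[G] := [ffun v => (v == u)%:R].

Definition convolution f g : R[G] := [ffun v => \sum_w f w * g (v - w)].

Lemma convolutionC : commutative convolution.
Proof.
move=> f g; apply/ffunP => v; rewrite !ffunE.
rewrite (reindex_inj (inv_inj (subKr v))).
by apply: eq_bigr => w _; rewrite subKr mulrC.
Qed.

Lemma convolutionA : associative convolution.
Proof.
move=> f g h; apply/ffunP => v; rewrite !ffunE.
under eq_bigr do rewrite ffunE mulr_sumr.
under [RHS]eq_bigr do rewrite ffunE mulr_suml.
rewrite [RHS]exchange_big; apply: eq_bigr => w _ /=.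
rewrite [RHS](reindex_inj (addIr w)); apply: eq_bigr => u _ /=.
by rewrite addrK mulrA opprD [- u - w]addrC addrA.
Qed.

Lemma convolution_dirac u f v : convolution (dirac u) f v = f (v - u).
Proof.
rewrite ffunE (bigD1 u) //= ffunE eqxx mul1r big1 ?addr0 // => w /negPf wu.
by rewrite ffunE wu mul0r.
Qed.

Lemma convolution1 : left_id (dirac 0) convolution.
Proof. by move=> f; apply/ffunP => v; rewrite convolution_dirac subr0. Qed.

Lemma convolutionDl : left_distributive convolution +%R.
Proof.
move=> f g h; apply/ffunP => v; rewrite !ffunE -big_split.
by apply: eq_bigr => w _; rewrite ffunE mulrDl.
Qed.

HB.instance Definition _ := GRing.Zmodule_isComPzRing.Build R[G]
  convolutionA convolutionC convolution1 convolutionDl.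

Lemma galg1E v : (1 : R[G]) v = (v == 0)%:R.
Proof. by rewrite ffunE. Qed.

Lemma galgME f g v : (f * g) v = \sum_w f w * g (v - w).
Proof. by rewrite ffunE. Qed.

Lemma galg_natrM n f v : (n%:R * f) v = n%:R * f v.
Proof. by rewrite !mulr_natl ffunMnE. Qed.

Lemma galg_intrM (z : int) f v : (z%:~R * f) v = z%:~R * f v.
Proof.
case: z => n; first exact: galg_natrM.
by rewrite NegzE !mulrNz !mulNr ffunE galg_natrM.
Qed.

Lemma dirac0 : dirac 0 = 1.
Proof. by []. Qed.

Lemma diracD : {morph dirac : u v / u + v >-> u * v}.
Proof.
move=> u v; apply/ffunP => w.
by rewrite [RHS]convolution_dirac !ffunE subr_eq addrC.
Qed.

Lemma dirac_sum (I : finType) (F : I -> G) :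
  dirac (\sum_i F i) = \prod_i dirac (F i).
Proof. exact: (big_morph _ diracD dirac0). Qed.

Definition norm_elt : R[G] := [ffun=> 1].

Lemma sum_dirac : \sum_u dirac u = norm_elt.
Proof.
apply/ffunP => v; rewrite sum_ffunE ffunE (bigD1 v) //= ffunE eqxx.
by rewrite big1 ?addr0 // => u uv; rewrite ffunE eq_sym (negPf uv).
Qed.

Lemma norm_elt_mulE f v : (norm_elt * f) v = \sum_w f w.
Proof.
by rewrite mulrC galgME; apply: eq_bigr => w _; rewrite ffunE mulr1.
Qed.

Lemma norm_elt_sqr : norm_elt * norm_elt = #|G|%:R * norm_elt.
Proof.
apply/ffunP => v; rewrite norm_elt_mulE galg_natrM ffunE mulr1 -sumr_const.
by apply: eq_bigr => w _; rewrite ffunE.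
Qed.

End GroupAlgebra.

Lemma sum_nat_of_bool (T : finType) (A p : pred T) :
  (\sum_(x | A x) p x)%N = #|[pred x | A x & p x]|.
Proof.
by rewrite -sum1_card big_mkcondr; apply: eq_bigr => x _; case: (p x).
Qed.

Section FiniteFieldUnits.

Variable F : finFieldType.
Implicit Types (x y v : F) (d s : nat).

Lemma card_finField_gt0 : (0 < #|F|)%N.
Proof. exact: ltnW (finNzRing_gt1 F). Qed.

Lemma card_finField_pred_gt0 : (0 < #|F|.-1)%N.
Proof. by rewrite -subn1 subn_gt0 finNzRing_gt1. Qed.

Lemma natr_card_finField_pred (R : pzRingType) : #|F|.-1%:R = #|F|%:R - 1 :> R.
Proof. by rewrite -subn1 natrB // card_finField_gt0. Qed.

Lemma expf_card_pred x : x != 0 -> x ^+ #|F|.-1 = 1.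
Proof.
move=> x0; apply: (mulfI x0).
by rewrite -exprS prednK ?card_finField_gt0 // expf_card mulr1.
Qed.

Section SumsOverUnits.

Variable V : nmodType.
Implicit Types (g : F -> V) (c : V).

Lemma sum_units_const c : \sum_(x : F | x != 0) c = c *+ #|F|.-1.
Proof.
by rewrite sumr_const -(cardC1 (0 : F)); congr (_ *+ _); apply: eq_card.
Qed.

Lemma sum_units_scale y g :
  y != 0 -> \sum_(x | x != 0) g (y * x) = \sum_(x | x != 0) g x.
Proof.
move=> y0; rewrite [RHS](reindex_inj (mulfI y0)) /=.
by apply: eq_bigl => x; rewrite mulf_eq0 (negPf y0).
Qed.

Lemma sum_units_inv g : \sum_(x | x != 0) g x^-1 = \sum_(x | x != 0) g x.
Proof.
by rewrite [RHS](reindex_inj invr_inj); apply: eq_bigl => x; rewrite invr_eq0.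
Qed.

(* Substituting [x ^- (d %/ s) * y] for [y] performs one step of the Euclidean
   algorithm on the exponents. *)
Lemma sum_units_expr_gcd d s g :
  \sum_(x | x != 0) \sum_(y | y != 0) g (x ^+ d * y ^+ s)
  = (\sum_(x | x != 0) g (x ^+ gcdn d s)) *+ #|F|.-1.
Proof.
elim/ltn_ind: s d => s IHs d; have [->|s_gt0] := posnP s.
  rewrite gcdn0 -sumrMnl; apply: eq_bigr => x _; rewrite -sum_units_const.
  by apply: eq_bigr => y _; rewrite mulr1.
rewrite -gcdn_modl gcdnC -IHs ?ltn_pmod // [RHS]exchange_big /=.
apply: eq_bigr => x x0; have xq0 : x ^- (d %/ s) != 0.
  by rewrite invr_eq0 expf_neq0.
rewrite -[LHS](sum_units_scale (fun y => g (x ^+ d * y ^+ s)) xq0).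
apply: eq_bigr => y _; congr g.
rewrite {1}(divn_eq d s) exprD exprM exprMn exprVn mulrACA.
by rewrite divff ?expf_neq0 // mul1r mulrC.
Qed.

End SumsOverUnits.

Lemma card_units_expr_gcd d v :
  #|[pred x | x != 0 & x ^+ d == v]|
  = #|[pred x | x != 0 & x ^+ gcdn d #|F|.-1 == v]|.
Proof.
have cardE e : (#|[pred x | x != 0 & x ^+ e == v]|%:R)%R
    = (\sum_(x | x != 0) (x ^+ e == v)%:R)%R :> int.
  by rewrite -sum_nat_of_bool natr_sum.
apply/eqP; rewrite -(eqr_nat int) !cardE; apply/eqP.
apply: (pmulrnI card_finField_pred_gt0).
have /= <- := sum_units_expr_gcd d #|F|.-1 (fun w => (w == v)%:R : int).
rewrite -sumrMnl; apply: eq_bigr => x _; rewrite -sum_units_const.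
by apply: eq_bigr => y y0; rewrite expf_card_pred // mulr1.
Qed.

Lemma sum_units_expr_gcd_card (V : nmodType) (g : F -> V) d :
  \sum_(x | x != 0) g (x ^+ d) = \sum_(x | x != 0) g (x ^+ gcdn d #|F|.-1).
Proof.
have fiberE e : \sum_(x | x != 0) g (x ^+ e)
    = \sum_v g v *+ #|[pred x | x != 0 & x ^+ e == v]|.
  rewrite (partition_big (fun x => x ^+ e) predT) //=; apply: eq_bigr => v _.
  by rewrite -sumr_const; apply: eq_bigr => x /andP[_ /eqP ->].
by rewrite !fiberE; apply: eq_bigr => v _; rewrite card_units_expr_gcd.
Qed.

Lemma sum_units_exprz_coprime (V : nmodType) (g : F -> V) (z : int) :
  gcdz z #|F|.-1 = 1 -> \sum_(x | x != 0) g (x ^ z) = \sum_(x | x != 0) g x.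
Proof.
move=> zq; have sumXn d : gcdn d #|F|.-1 = 1%N ->
    \sum_(x | x != 0) g (x ^+ d) = \sum_(x | x != 0) g x.
  by move=> dq; rewrite sum_units_expr_gcd_card dq.
case: z zq => d [/sumXn <-]; first by apply: eq_bigr.
rewrite -[RHS]sum_units_inv; apply: eq_bigr => x _.
by rewrite NegzE exprVn -exprnN.
Qed.

Lemma sum_units_expr_eq (A B : nat) (u v : F) :
  v != 0 -> gcdz (A%:Z - B%:Z) #|F|.-1 = 1 ->
  (\sum_(c : F | c != 0%R) (c ^+ B * u == c ^+ A * v)%R)%N = (u != 0).
Proof.
move=> v0 cop; transitivity (\sum_(c : F | c != 0%R) (c == u / v)%R)%N.
  rewrite -(sum_units_exprz_coprime (fun c => nat_of_bool (c == u / v)) cop).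
  apply: eq_bigr => c c0; congr nat_of_bool; rewrite expfzDr // -exprnN.
  by rewrite eqr_div ?expf_neq0 // [RHS]eq_sym [u * _]mulrC.
have [->|u0] := eqVneq u 0; first by rewrite mul0r big1 // => c /negPf ->.
rewrite (bigD1 (u / v)) ?mulf_neq0 ?invr_eq0 //= eqxx big1 //.
by move=> c /andP[_ /negPf ->].
Qed.

End FiniteFieldUnits.

Section QuadraticCharacter.

Variable F : finFieldType.
Implicit Types x y v : F.

Variant qeta_spec x : int -> Type :=
  | QetaZero of x = 0 : qeta_spec x 0
  | QetaSquare y of y != 0 & x = y ^+ 2 : qeta_spec x 1
  | QetaNonsquare of x != 0 & (forall y, y ^+ 2 != x) : qeta_spec x (-1).

Lemma qetaP x : qeta_spec x (qeta x).
Proof.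
rewrite /qeta; have [->|x0] := eqVneq x 0; first exact: QetaZero.
have [/existsP/sigW[y /eqP yx]|/existsPn nsq] := ifPn; last first.
  exact: QetaNonsquare.
apply: (@QetaSquare x y) => //.
by apply: contraNneq x0 => y0; rewrite -yx y0 expr0n.
Qed.

Lemma qeta0 : qeta (0 : F) = 0.
Proof. by rewrite /qeta eqxx. Qed.

Lemma qeta_sqr x : x != 0 -> qeta (x ^+ 2) = 1.
Proof.
move=> x0; rewrite /qeta expf_eq0 (negPf x0) ifT //.
by apply/existsP; exists x.
Qed.

Lemma qeta1 : qeta (1 : F) = 1.
Proof. by rewrite -(expr1n F 2) qeta_sqr ?oner_eq0. Qed.

Lemma qeta_sqr_mul y x : y != 0 -> qeta (y ^+ 2 * x) = qeta x.
Proof.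
move=> y0; case: (qetaP x) => [->|w w0 ->|x0 nsq].
- by rewrite mulr0 qeta0.
- by rewrite -exprMn qeta_sqr ?mulf_neq0.
case: (qetaP (y ^+ 2 * x)) => // [/eqP|w w0 wE].
  by rewrite mulf_eq0 expf_eq0 (negPf y0) (negPf x0).
case/eqP: (nsq (w / y)).
by rewrite expr_div_n -wE mulrC mulKf ?expf_neq0.
Qed.

Lemma qetaV x : qeta x^-1 = qeta x.
Proof.
have [->|x0] := eqVneq x 0; first by rewrite invr0.
by rewrite -(qeta_sqr_mul x^-1 x0) expr2 mulfK.
Qed.

Hypothesis odd_q : odd #|F|.

Lemma odd_card_two_neq0 : 2%:R != 0 :> F.
Proof.
apply/negP => F2; have pcharF2 : 2 \in [pchar F] by rewrite inE.
have := finNzRing_gt1 F.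
by rewrite -cardsT (pnat_1 (pprimeChar_pgroup pcharF2)) // cardsT -odd_2'nat.
Qed.

Lemma sum_eq_sqr v : \sum_x (x ^+ 2 == v)%:R = 1 + qeta v.
Proof.
case: (qetaP v) => [->|y y0 ->|v0 nsq].
- rewrite (bigD1 0) //= expr0n eqxx big1 ?addr0 // => x x0.
  by rewrite expf_eq0 (negPf x0).
- have yN : - y != y.
    rewrite -subr_eq0 -opprD oppr_eq0 -mulr2n -mulr_natl.
    by rewrite mulf_neq0 ?odd_card_two_neq0.
  rewrite (bigD1 y) //= (bigD1 (- y)) //= sqrrN eqxx big1 ?addr0 //.
  by move=> x /andP[xy xNy]; rewrite eqf_sqr (negPf xy) (negPf xNy).
by rewrite subrr big1 // => x _; rewrite (negPf (nsq x)).
Qed.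

Lemma sum_qeta : \sum_x qeta (x : F) = 0.
Proof.
have : \sum_(v : F) \sum_x (x ^+ 2 == v)%:R = \sum_(x : F) (1 : int).
  rewrite exchange_big; apply: eq_bigr => x _.
  rewrite (bigD1 (x ^+ 2)) //= eqxx big1 ?addr0 // => v.
  by rewrite eq_sym => /negPf ->.
under eq_bigr do rewrite sum_eq_sqr.
by rewrite big_split -[RHS]addr0 => /addrI.
Qed.

(* For a non-square [x], no term of [\sum_y (qeta (x * y) + qeta y)] is
   positive; as the sum is [0], all its terms vanish. *)
Lemma qetaM x y : qeta (x * y) = qeta x * qeta y.
Proof.
case: (qetaP x) => [->|w w0 ->|x0 nsq].
- by rewrite mul0r qeta0 mul0r.
- by rewrite qeta_sqr_mul // mul1r.
rewrite mulN1r; apply/eqP; rewrite -addr_eq0 -oppr_eq0; apply/eqP.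
move: y isT; apply/psumr_eq0P => [y _|].
  rewrite oppr_ge0; case: (qetaP y) => [->|w w0 ->|_ _].
  - by rewrite mulr0 qeta0.
  - rewrite mulrC qeta_sqr_mul // /qeta (negPf x0) ifN // negb_exists.
    exact/forallP.
  by case: (qetaP (x * y)).
rewrite sumrN big_split /= sum_qeta addr0.
by have := sum_qeta; rewrite (reindex_inj (mulfI x0)) => ->; rewrite oppr0.
Qed.

Lemma qetaX x k : qeta (x ^+ k) = qeta x ^+ k.
Proof. by elim: k => [|k IHk]; rewrite ?qeta1 // !exprS qetaM IHk. Qed.

Lemma qeta_prod (I : finType) (f : I -> F) :
  qeta (\prod_i f i) = \prod_i qeta (f i).
Proof. exact: (big_morph _ qetaM qeta1). Qed.

Lemma sum_qetaM_sub v :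
  \sum_w qeta w * qeta (v - w) = qeta (-1 : F) * (#|F|%:R * (v == 0)%:R - 1).
Proof.
rewrite (bigD1 0) //= qeta0 mul0r add0r; have [->|v0] := eqVneq v 0.
  rewrite mulr1 -natr_card_finField_pred mulr_natr -sum_units_const.
  apply: eq_bigr => w w0.
  by rewrite sub0r -qetaM mulrN -expr2 -mulrN1 qeta_sqr_mul.
transitivity (\sum_(w | w != 0) qeta (v * w^-1 - 1)).
  apply: eq_bigr => w w0; rewrite -qetaM -(qeta_sqr_mul (v * w^-1 - 1) w0).
  by congr qeta; field.
rewrite (sum_units_inv (fun w => qeta (v * w - 1))).
rewrite (sum_units_scale (fun w => qeta (w - 1)) v0) mulr0 sub0r mulrN1.
have := sum_qeta; rewrite (reindex_inj (addIr (-1))) (bigD1 0) //= sub0r.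
by move/eqP; rewrite addrC addr_eq0 => /eqP.
Qed.

End QuadraticCharacter.

Definition gauss_elt (F : finFieldType) : group_algebra int F :=
  [ffun x => qeta x].

Section GaussElement.

Variable F : finFieldType.
Hypothesis odd_q : odd #|F|.
Local Notation N := (norm_elt int F).
Local Notation G := (gauss_elt F).

Lemma norm_elt_gauss_elt : N * G = 0.
Proof.
apply/ffunP => v; rewrite norm_elt_mulE ffunE -[RHS](sum_qeta odd_q).
by apply: eq_bigr => x _; rewrite ffunE.
Qed.

Lemma gauss_elt_sqr : G ^+ 2 = (qeta (-1 : F))%:~R * (#|F|%:R - N).
Proof.
apply/ffunP => v; rewrite galgME galg_intrM intz !ffunE ffunMnE galg1E.
rewrite -[_ *+ #|F|]mulr_natl -sum_qetaM_sub //.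
by apply: eq_bigr => w _; rewrite !ffunE.
Qed.

Lemma sum_dirac_sqr (a : F) : a != 0 ->
  \sum_x dirac int (a * x ^+ 2) = N + (qeta a)%:~R * G.
Proof.
move=> a0; apply/ffunP => v; rewrite sum_ffunE ffunE galg_intrM intz !ffunE.
rewrite -(qetaV a) -qetaM // -sum_eq_sqr //.
apply: eq_bigr => x _; rewrite ffunE; congr (nat_of_bool _)%:R.
by rewrite eq_sym -(inj_eq (mulfI (invr_neq0 a0))) mulKf.
Qed.

Lemma gauss_elt_exp_double j :
  (#|F|%:R - N) * G ^+ j.*2
  = (qeta ((-1) ^+ j : F) * #|F|%:R ^+ j)%:~R * (#|F|%:R - N).
Proof.
elim: j => [|j IHj]; first by rewrite !expr0 qeta1 !mulr1 mul1r.
have qN2 : (#|F|%:R - N) * (#|F|%:R - N) = #|F|%:R * (#|F|%:R - N).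
  by rewrite mulrBl !mulrBr norm_elt_sqr (mulrC N) subrr subr0.
rewrite doubleS -addn2 exprD mulrA IHj gauss_elt_sqr // mulrACA qN2.
by rewrite !qetaX // !exprSr !rmorphM !rmorphXn rmorph_nat /=; ring.
Qed.

End GaussElement.

Lemma gauss_elt_exp_coef0 (F : finFieldType) j : ((0 < j)%N -> odd #|F|) ->
  ((#|F|%:R - norm_elt int F) * gauss_elt F ^+ j) 0
  = if odd j then 0
    else qeta ((-1) ^+ j./2 : F) * #|F|%:R ^+ j./2 * (#|F|%:R - 1).
Proof.
have coef0 : (#|F|%:R - norm_elt int F) 0 = #|F|%:R - 1.
  by rewrite !ffunE ffunMnE galg1E eqxx.
have [->|j_gt0 /(_ isT) odd_q] := posnP j.
  by rewrite !expr0 qeta1 !mulr1 mul1r.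
rewrite -[in LHS](odd_double_half j) addnC exprD mulrA.
rewrite gauss_elt_exp_double // -[in LHS]mulrA galg_intrM intz.
case: (odd j); last by rewrite mulr1 coef0.
rewrite mulrBl norm_elt_gauss_elt // subr0 galg_natrM ffunE qeta0.
by rewrite !mulr0.
Qed.

(* [u] and [q - u] are orthogonal, and add up to [q]. *)
Lemma prod_add_absorbing (A : comPzRingType) (I : finType) (u c q : A)
    (g : I -> A) :
  u * u = q * u -> (forall i, u * g i = c * u) ->
  q * \prod_i (u + g i) = (q + c) ^+ #|I| * u + (q - u) * \prod_i g i.
Proof.
move=> uu ug.
have uP : u * \prod_i (u + g i) = (q + c) ^+ #|I| * u.
  rewrite -prodr_const mulrC.
  apply: (big_ind2 (fun x y => x * u = y * u)) => // [x x' y y' xE yE|i _].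
    by rewrite -mulrA yE mulrCA xE mulrCA mulrA.
  by rewrite mulrC mulrDr uu ug mulrDl.
have quP : (q - u) * \prod_i (u + g i) = (q - u) * \prod_i g i.
  apply: (big_ind2 (fun x y => (q - u) * x = (q - u) * y)) => //.
    by move=> x x' y y' xE yE; rewrite mulrA xE mulrAC yE mulrAC mulrA.
  by move=> i _; rewrite mulrDr mulrBl uu subrr add0r.
by rewrite -uP -quP -mulrDl subrKC.
Qed.

Lemma prod_add_mul (A : comPzRingType) (I : finType) (c g : A) (f : I -> A) :
  \prod_i (c + f i * g)
  = \sum_(J : {set I}) c ^+ (#|I| - #|J|) * (\prod_(i in J) f i) * g ^+ #|J|.
Proof.
under eq_bigr do rewrite addrC; rewrite bigA_distr; apply: eq_bigr => J _.
rewrite big_if /= mulrC -mulrA -prodr_const -big_split; congr (_ * _).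
by rewrite prodr_const -(cardC J) addKn.
Qed.

Lemma max_card_ord n (A : {pred 'I_n}) : (#|A| <= n)%N.
Proof. by rewrite -[n in leqRHS]card_ord max_card. Qed.

Lemma card_ord_geq n t : #|[pred i : 'I_n | (t <= i)%N]| = (n - t)%N.
Proof.
rewrite -sum1_card -(big_geq_mkord t n xpredT (fun=> 1%N)).
by rewrite sum_nat_const_nat muln1.
Qed.

Section ElementarySymmetric.

Variables (n : nat) (P : {pred 'I_n}) (f : 'I_n -> int).

Lemma esym_at0 : esym_at P f 0 = 1.
Proof.
rewrite /esym_at (big_pred1 set0) ?big_set0 // => J /=.
by rewrite cards_eq0 andb_idl // => /eqP ->; apply/subsetP => i; rewrite inE.
Qed.

Lemma esym_at_full : #|P| = n -> esym_at P f n = \prod_i f i.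
Proof.
move=> cardP; have PT : P =i predT.
  by apply/subset_cardP; rewrite ?subset_predT ?cardP ?card_ord.
rewrite /esym_at (big_pred1 setT) => [|J /=].
  by apply: eq_bigl => i; rewrite inE.
rewrite eqEcard subsetT cardsT card_ord (eq_subset_r PT) subset_predT /=.
by rewrite eqn_leq max_card_ord.
Qed.

Lemma sum_even_subset_esym_at (K : nat -> int) :
  \sum_(J : {set 'I_n}) (if odd #|J| then 0 else
     K #|J|./2 * \prod_(i in J) (if i \in P then f i else 0))
  = \sum_(0 <= j < #|P|./2.+1) K j * esym_at P f (2 * j).
Proof.
rewrite (bigID (fun J : {set 'I_n} => J \subset P)) /=.
rewrite [X in _ + X]big1 ?addr0 => [|J /subsetPn[i iJ /negPf iP]]; last first.
  by rewrite (bigD1 i) //= iP mul0r mulr0 if_same.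
rewrite big_mkord; under [RHS]eq_bigr do rewrite mulr_sumr.
rewrite (exchange_big_dep (fun J : {set 'I_n} => J \subset P)) /=; last first.
  by move=> j J _ /andP[].
apply: eq_bigr => J JP; rewrite JP /=; have [oddJ|evenJ] := ifPn.
  rewrite big_pred0 // => j; apply: contraTF oddJ => /eqP ->.
  by rewrite mul2n odd_double.
have J2 : (#|J|./2 < #|P|./2.+1)%N by rewrite ltnS half_leq ?subset_leq_card.
rewrite (big_pred1 (Ordinal J2)) => [|j /=].
  by congr (_ * _); apply: eq_bigr => i iJ; rewrite (subsetP JP).
by rewrite mul2n -{1}(even_halfK evenJ) (inj_eq double_inj) eq_sym.
Qed.

End ElementarySymmetric.

Lemma coef0_prod_norm_gauss_elt (F : finFieldType) n (P : {pred 'I_n})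
    (f : 'I_n -> int) (c : int) :
  (forall i, i \in P -> odd #|F|) ->
  #|F|%:R * (\prod_i (norm_elt int F + (c%:~R
     + (if i \in P then f i else 0)%:~R * gauss_elt F))) 0
  = (#|F|%:R + c) ^+ n + (#|F|%:R - 1) * \sum_(0 <= j < #|P|./2.+1)
      c ^+ (n - 2 * j)
      * (qeta ((-1) ^+ j : F) * esym_at P f (2 * j) * #|F|%:R ^+ j).
Proof.
set N := norm_elt int F; set G := gauss_elt F; set q := #|F|.
move=> oddP; pose fP i := if i \in P then f i else 0.
have NG i : N * (c%:~R + (fP i)%:~R * G) = c%:~R * N.
  rewrite mulrDr mulrCA mulrC /fP; case: ifP => [iP|_].
    by rewrite norm_elt_gauss_elt ?(oddP i) // mulr0 addr0.
  by rewrite mul0r addr0.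
rewrite -galg_natrM (prod_add_absorbing (norm_elt_sqr int F) NG) ffunE.
congr (_ + _).
  rewrite -[_ + _]/(q%:~R + c%:~R) -rmorphD -rmorphXn galg_intrM.
  by rewrite ffunE mulr1 natz card_ord intz.
pose K j :=
  c ^+ (n - 2 * j) * (qeta ((-1) ^+ j : F) * q%:R ^+ j) * (q%:R - 1).
transitivity (\sum_(0 <= j < #|P|./2.+1) K j * esym_at P f (2 * j)).
  rewrite -sum_even_subset_esym_at prod_add_mul mulr_sumr sum_ffunE.
  apply: eq_bigr => J _; rewrite -rmorphXn -rmorph_prod -rmorphM mulrCA.
  rewrite galg_intrM intz card_ord /=.
  have [JP|/subsetPn[i iJ /negPf iP]] := boolP (J \subset P); last first.
    by rewrite !(bigD1 i iJ) /= /fP iP !(mul0r, mulr0) if_same.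
  rewrite gauss_elt_exp_coef0 => [|/card_gt0P[i /(subsetP JP)/oddP]] //.
  case: ifPn => [_|evenJ]; first by rewrite mulr0.
  by rewrite /K mul2n even_halfK //; ring.
by rewrite mulr_sumr; apply: eq_bigr => j _; rewrite /K; ring.
Qed.

Definition power_elt {F : finFieldType} (D : {pred F}) (d : nat) (a : F) :
    group_algebra int F :=
  \sum_(x in D) dirac int (a * x ^+ d).

Section PowerElements.

Variables (F : finFieldType) (D : {pred F}).
Hypothesis unitsD : forall x : F, x != 0 -> x \in D.
Implicit Types (x y a : F) (d s : nat).

Lemma sum_zero_units (V : nmodType) (g : F -> V) :
  \sum_(x in D) g x = g 0 *+ (0 \in D) + \sum_(x | x != 0) g x.
Proof.
have unitsE : (fun x => (x \in D) && (x != 0)) =1 (fun x => x != 0).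
  by move=> x; rewrite andb_idl // => /unitsD.
have [D0|D0] := boolP (0 \in D).
  by rewrite (bigD1 0) //= (eq_bigl _ _ unitsE).
rewrite add0r -(eq_bigl _ _ unitsE); apply: eq_bigl => x.
by rewrite andb_idr // => xD; apply: contraNneq D0 => <-.
Qed.

Lemma power_elt_mul_expr d y a :
  y != 0 -> power_elt D d (a * y ^+ d) = power_elt D d a.
Proof.
move=> y0; rewrite /power_elt [RHS](reindex_inj (mulfI y0)).
apply: eq_big => x; last by rewrite exprMn mulrA.
by have [->|x0] := eqVneq x 0; rewrite ?mulr0 // !unitsD ?mulf_neq0.
Qed.

Lemma sum_power_elt d s a : (0 < d)%N ->
  \sum_(y | y != 0) power_elt D d (a * y ^+ s)
  = power_elt D (gcdn d s) a *+ #|F|.-1.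
Proof.
move=> d_gt0; rewrite /power_elt sum_zero_units.
under eq_bigr do rewrite sum_zero_units !expr0n gtn_eqF // mulr0.
rewrite big_split /= sum_units_const mulrnDl expr0n gtn_eqF ?gcdn_gt0 ?d_gt0 //.
rewrite mulr0; congr (_ + _).
rewrite -(sum_units_expr_gcd d s (fun w => dirac int (a * w))).
rewrite exchange_big; apply: eq_bigr => x _; apply: eq_bigr => y _ /=.
by rewrite -mulrA [y ^+ s * _]mulrC.
Qed.

Lemma power_elt_gcd_card d a : (0 < d)%N ->
  power_elt D d a = power_elt D (gcdn d #|F|.-1) a.
Proof.
move=> d_gt0; rewrite /power_elt !sum_zero_units !expr0n.
rewrite !gtn_eqF ?gcdn_gt0 ?d_gt0 //.
by rewrite (sum_units_expr_gcd_card (fun y => dirac int (a * y))).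
Qed.

Lemma power_elt1 a : a != 0 ->
  power_elt D 1 a = norm_elt int F + (- (0 \notin D)%:R : int)%:~R.
Proof.
move=> a0; rewrite /power_elt sum_zero_units; under eq_bigr do rewrite expr1.
rewrite (sum_units_scale (@dirac int F) a0) -sum_dirac [in RHS](bigD1 0) //=.
by rewrite mulr0 dirac0; case: (0 \in D) => /=; rewrite mulrNz; ring.
Qed.

Lemma power_elt2 a : odd #|F| -> a != 0 ->
  power_elt D 2 a = norm_elt int F
    + ((- (0 \notin D)%:R : int)%:~R + (qeta a)%:~R * gauss_elt F).
Proof.
move=> odd_q a0; rewrite addrCA -sum_dirac_sqr // (bigD1 0) //=.
rewrite /power_elt sum_zero_units expr0n mulr0 dirac0.
by case: (0 \in D) => /=; rewrite mulrNz; ring.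
Qed.

End PowerElements.

Definition diag_form {F : finFieldType} {n : nat} (a : 'I_n -> F)
    (d : 'I_n -> nat) (x : {ffun 'I_n -> F}) : F :=
  \sum_i a i * x i ^+ d i.

Definition diag_zeros {F : finFieldType} {n : nat} (D : {pred F})
    (a : 'I_n -> F) (d : 'I_n -> nat) : nat :=
  #|[set x in ffun_on D | diag_form a d x == 0]|.

Lemma coef0_prod_power_elt (F : finFieldType) n (D : {pred F}) (a : 'I_n -> F)
    (d : 'I_n -> nat) :
  (\prod_i power_elt D (d i) (a i)) 0 = (diag_zeros D a d)%:R.
Proof.
rewrite /power_elt bigA_distr_big /= sum_ffunE.
rewrite /diag_zeros cardsE -sum_nat_of_bool natr_sum.
by apply: eq_bigr => x _; rewrite -dirac_sum ffunE eq_sym.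
Qed.

Lemma coprimen_prod (I : finType) (P : pred I) (f : I -> nat) m :
  (forall i, P i -> coprime m (f i)) -> coprime m (\prod_(i | P i) f i).
Proof.
move=> cop; apply: (big_ind (coprime m)) => // [|x y mx my].
  exact: coprimen1.
by rewrite coprimeMr mx.
Qed.

Section DiagonalZeros.

Variables (F : finFieldType) (n : nat) (D : {pred F}) (a : 'I_n -> F).
Implicit Types d e s : 'I_n -> nat.

Lemma eq_diag_zeros d e : d =1 e -> diag_zeros D a d = diag_zeros D a e.
Proof.
move=> de; apply: eq_card => x; rewrite !inE; congr (_ && (_ == _)).
by apply: eq_bigr => i _; rewrite de.
Qed.

Lemma diag_zeros_scale d (c : F) :
  c != 0 -> diag_zeros D (fun i => a i * c) d = diag_zeros D a d.
Proof.
move=> c0; apply: eq_card => x; rewrite !inE; congr (_ && _).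
rewrite /diag_form; under eq_bigr do rewrite mulrAC.
by rewrite -mulr_suml mulf_eq0 (negPf c0) orbF.
Qed.

Hypothesis unitsD : forall x : F, x != 0 -> x \in D.

Lemma diag_zeros_gcd_card d : (forall i, 0 < d i)%N ->
  diag_zeros D a d = diag_zeros D a (fun i => gcdn (d i) #|F|.-1).
Proof.
move=> d_gt0; apply/eqP; rewrite -(eqr_nat int) -!coef0_prod_power_elt.
by under eq_bigr do rewrite power_elt_gcd_card //.
Qed.

(* Up to [d i]-th powers, the factor [\prod_j y j ^+ s j] by which the equation
   is scaled reduces to [y i ^+ s i] in the i-th term. *)
Lemma coef0_prod_power_elt_mul_expr d s (y : 'I_n -> F) :
  (forall i j, j != i -> d i %| s j)%N -> (forall i, y i != 0) ->
  (\prod_i power_elt D (d i) (a i * y i ^+ s i)) 0 = (diag_zeros D a d)%:R.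
Proof.
move=> ds y0; have prod0 : \prod_j y j ^+ s j != 0.
  by apply/prodf_neq0 => j _; rewrite expf_neq0.
rewrite -(diag_zeros_scale d prod0) -coef0_prod_power_elt.
congr (fun_of_fin _ 0); apply: eq_bigr => i _.
have -> : \prod_j y j ^+ s j
    = y i ^+ s i * (\prod_(j | j != i) y j ^+ (s j %/ d i)) ^+ d i.
  rewrite (bigD1 i) //= -prodrXl; congr (_ * _); apply: eq_bigr => j ji.
  by rewrite -exprM divnK ?ds.
rewrite mulrA power_elt_mul_expr //.
by apply/prodf_neq0 => j _; rewrite expf_neq0.
Qed.

Lemma diag_zeros_gcd d s :
  (forall i, 0 < d i)%N -> (forall i j, j != i -> d i %| s j)%N ->
  diag_zeros D a d = diag_zeros D a (fun i => gcdn (d i) (s i)).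
Proof.
move=> d_gt0 ds; pose units := [pred y : F | y != 0].
have units_gt0 : (0 < #|F|.-1 ^ n)%N.
  by rewrite expn_gt0 card_finField_pred_gt0.
apply/eqP; rewrite -(eqr_nat int); apply/eqP/(pmulrnI units_gt0).
transitivity (\sum_(y : {ffun 'I_n -> F} | y \in ffun_on units)
                ((diag_zeros D a d)%:R : int)).
  rewrite sumr_const card_ffun_on card_ord; congr (_ *+ _ ^ _).
  by rewrite -(cardC1 (0 : F)); apply: eq_card.
transitivity
  ((\prod_i \sum_(y in units) power_elt D (d i) (a i * y ^+ s i)) 0).
  rewrite bigA_distr_big sum_ffunE; apply: eq_bigr => y /ffun_onP y0.
  by rewrite coef0_prod_power_elt_mul_expr.
under eq_bigr do rewrite sum_power_elt //.
by rewrite prodrMn_const card_ord ffunMnE coef0_prod_power_elt.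
Qed.

Lemma diag_zeros_pairwise_coprime d (P : {pred 'I_n}) :
  (forall i, 0 < d i)%N -> (forall i, (i \in P) = ~~ odd (d i)) ->
  (forall i j, i != j -> coprime (if i \in P then (d i)./2 else d i)
                                 (if j \in P then (d j)./2 else d j)) ->
  diag_zeros D a d = diag_zeros D a (fun i => if i \in P then 2 else 1)%N.
Proof.
move=> d_gt0 mem_P cop; pose e i := (if i \in P then 2 else 1)%N.
pose r i := if i \in P then (d i)./2 else d i.
have dE i : d i = (e i * r i)%N.
  rewrite /e /r; case: ifP; last by rewrite mul1n.
  by rewrite mem_P mul2n => /even_halfK.
pose s i := (2 * \prod_(j | j != i) r j)%N.
have rs i : coprime (r i) (\prod_(j | j != i) r j).
  by apply: coprimen_prod => j ji; rewrite cop // eq_sym.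
rewrite (@diag_zeros_gcd d s) // => [|i j ji].
  apply: eq_diag_zeros => i; rewrite /s; have [iP|iP] := boolP (i \in P).
    by rewrite dE /e iP -muln_gcdr (eqP (rs i)).
  apply/eqP; rewrite -[_ == _]/(coprime _ _) coprimeMr coprimen2.
  move: (rs i); rewrite /r (negPf iP) => ->.
  by move: iP; rewrite mem_P negbK => ->.
rewrite dE /s (bigD1 i) 1?eq_sym //= dvdn_mul ?dvdn_mulr //.
by rewrite /e; case: ifP.
Qed.

End DiagonalZeros.

Section WeightedScaling.

Variables (F : finFieldType) (n : nat).
Implicit Types (x : {ffun 'I_n -> F}) (w m k : 'I_n -> nat) (c : F).

Definition weighted_scale w c x : {ffun 'I_n -> F} :=
  [ffun j => c ^+ w j * x j].

Lemma weighted_scaleK w c :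
  c != 0 -> cancel (weighted_scale w c) (weighted_scale w c^-1).
Proof.
move=> c0 x; apply/ffunP => j.
by rewrite !ffunE mulrA -exprMn mulVf // expr1n mul1r.
Qed.

Lemma weighted_scale_units w c x : c != 0 ->
  (weighted_scale w c x \in ffun_on (predC1 0)) = (x \in ffun_on (predC1 0)).
Proof.
move=> c0; apply/ffun_onP/ffun_onP => + j => /(_ j).
  by rewrite ffunE !inE mulf_eq0 => /norP[].
by rewrite ffunE !inE mulf_eq0 expf_eq0 (negPf c0) andbF.
Qed.

Lemma sum_weighted_scale (V : nmodType) w c (g : {ffun 'I_n -> F} -> V) :
  c != 0 ->
  \sum_(x in ffun_on (predC1 0)) g (weighted_scale w c x)
  = \sum_(x in ffun_on (predC1 0)) g x.
Proof.
move=> c0; rewrite [RHS](reindex (weighted_scale w c)) /=.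
  by apply: eq_bigl => x; rewrite weighted_scale_units.
exists (weighted_scale w c^-1) => x _; first exact: weighted_scaleK.
by rewrite -{1}(invrK c) weighted_scaleK ?invr_eq0.
Qed.

Lemma diag_form_weighted_scale (a : 'I_n -> F) m w M c x :
  (forall j, w j * m j = M)%N ->
  diag_form a m (weighted_scale w c x) = c ^+ M * diag_form a m x.
Proof.
move=> wm; rewrite /diag_form mulr_sumr; apply: eq_bigr => j _.
by rewrite ffunE exprMn -exprM wm mulrCA.
Qed.

Lemma prod_weighted_scale w k c x :
  \prod_j weighted_scale w c x j ^+ k j
  = c ^+ (\sum_j k j * w j) * \prod_j x j ^+ k j.
Proof.
rewrite expr_sum -big_split; apply: eq_bigr => j _.
by rewrite ffunE exprMn -exprM mulnC.
Qed.

End WeightedScaling.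

Section Solutions.

Variables (F : finFieldType) (n : nat) (a : 'I_n -> F) (b : F).
Variables (m kk : 'I_n -> nat) (k : nat).
Local Notation q := #|F|.
Local Notation units := (ffun_on (predC1 (0 : F))).
Implicit Types (x : {ffun 'I_n -> F}) (w : 'I_n -> nat).

Definition solution x : bool :=
  diag_form a m x ^+ k == b * \prod_j x j ^+ kk j.

Hypothesis k_gt0 : (0 < k)%N.

Lemma card_units_solutions w M :
  b != 0 -> (forall j, w j * m j = M)%N ->
  gcdz ((\sum_j kk j * w j)%N%:Z - (k * M)%N%:Z) q.-1 = 1 ->
  (#|[set x in units | solution x]| * q.-1)%N
  = #|[set x in units | diag_form a m x != 0]|.
Proof.
move=> b_neq0 wm cop.
have solE c x : solution (weighted_scale w c x)
    = (c ^+ (k * M) * diag_form a m x ^+ k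
       == c ^+ (\sum_j kk j * w j) * (b * \prod_j x j ^+ kk j)).
  rewrite /solution (diag_form_weighted_scale _ _ _ wm) prod_weighted_scale.
  by rewrite exprMn -exprM mulnC [b * _]mulrCA.
pose count (p : pred {ffun 'I_n -> F}) := \sum_(x in units) (p x : nat).
have countE p : #|[set x in units | p x]| = count p.
  by rewrite cardsE -sum_nat_of_bool.
rewrite !countE; transitivity (\sum_(c : F | c != 0)
    count (fun x => solution (weighted_scale w c x))).
  rewrite (eq_bigr (fun=> count solution)) => [|c c0].
    by rewrite sum_units_const -mulr_natr natn.
  exact: (sum_weighted_scale w (fun x => nat_of_bool (solution x)) c0).
rewrite exchange_big; apply: eq_bigr => x /ffun_onP x0.
under eq_bigr do rewrite solE.
rewrite sum_units_expr_eq ?expf_eq0 ?k_gt0 // mulf_neq0 //.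
by apply/prodf_neq0 => j _; apply/expf_neq0/x0.
Qed.

Lemma card_units_diag_nonzeros :
  (#|[set x in units | diag_form a m x != 0%R]|
   + diag_zeros (predC1 0%R) a m)%N = (q.-1 ^ n)%N.
Proof.
rewrite /diag_zeros -[in RHS](cardC1 (0 : F)) -[in RHS](card_ord n).
rewrite -card_ffun_on -[in RHS]cardsE addnC.
rewrite -[in RHS](cardsID [set x | diag_form a m x == 0]).
by congr (_ + _)%N; apply: eq_card => x; rewrite !inE // andbC.
Qed.

Hypothesis kk_gt0 : forall j, (0 < kk j)%N.

Lemma solution_nonunits x :
  x \notin units -> solution x = (diag_form a m x == 0).
Proof.
rewrite negb_forall => /existsP[j]; rewrite inE negbK => /eqP xj.
rewrite /solution (bigD1 j) //= xj expr0n gtn_eqF // mul0r mulr0.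
by rewrite expf_eq0 k_gt0.
Qed.

Lemma card_solutions_split :
  (#|[set x | solution x]| + diag_zeros (predC1 0%R) a m
   = diag_zeros predT a m + #|[set x in units | solution x]|)%N.
Proof.
have predTE x : x \in ffun_on predT by apply/ffun_onP.
rewrite /diag_zeros -(cardsID [set x in units] [set x | solution x]).
rewrite -[in RHS](cardsID [set x in units] [set x in ffun_on predT | _]).
rewrite addnAC [RHS]addnAC; congr (_ + _)%N; last first.
  apply: eq_card => x; rewrite !in_setD !in_set predTE.
  by case: (boolP (x \in units)) => //; exact: solution_nonunits.
by rewrite addnC; congr (_ + _)%N; apply: eq_card => x;
  rewrite !in_setI !in_set ?predTE andbC.
Qed.

Lemma card_solutions_diag_zeros w M :
  b != 0 -> (forall j, w j * m j = M)%N ->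
  gcdz ((\sum_j kk j * w j)%N%:Z - (k * M)%N%:Z) q.-1 = 1 ->
  (q.-1 * #|[set x | solution x]| + q * diag_zeros (predC1 0%R) a m
   = q.-1 * diag_zeros predT a m + q.-1 ^ n)%N.
Proof.
move=> b_neq0 wm cop; have := card_solutions_split.
have := card_units_diag_nonzeros; rewrite -(card_units_solutions b_neq0 wm cop).
rewrite -{4}(prednK (card_finField_gt0 F)) => <- /(congr1 (muln q.-1)).
by rewrite !mulnDr => solE; rewrite mulSn; lia.
Qed.

End Solutions.

Section PairwiseCoprimeExponents.

Variables (F : finFieldType) (n : nat) (a : 'I_n -> F) (m : 'I_n -> nat).
Variable P : {pred 'I_n}.
Local Notation q := #|F|.
Local Notation d i := (gcdn (m i) q.-1).
Local Notation eta_esym_sum := (\sum_(1 <= j < #|P|./2.+1)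
  qeta ((-1) ^+ j : F) * esym_at P (fun i => qeta (a i)) (2 * j) * q%:R ^+ j).
Local Notation full_even_term := (if (#|P| == n) && ~~ odd n then
  qeta ((-1) ^+ n./2 * \prod_i a i) * q%:R ^+ (n - 2)./2 * (q%:R - 1) else 0).

Hypothesis a_neq0 : forall i, a i != 0.
Hypothesis m_gt0 : forall i, (0 < m i)%N.
Hypothesis mem_P : forall i, (i \in P) = ~~ odd (d i).
Hypothesis coprime_d : forall i j, i != j ->
  coprime (if i \in P then (d i)./2 else d i)
          (if j \in P then (d j)./2 else d j).

Lemma odd_card_even_gcd i : i \in P -> odd q.
Proof.
rewrite mem_P; apply: contraNT => even_q; apply: dvdn_odd (dvdn_gcdr _ _) _.
by rewrite -subn1 oddB ?card_finField_gt0 // (negPf even_q).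
Qed.

Lemma diag_zeros_esym_at (D : {pred F}) (c := - (0 \notin D)%:R : int) :
  (forall x : F, x != 0 -> x \in D) ->
  q%:R * (diag_zeros D a m)%:R
  = (q%:R + c) ^+ n + (q%:R - 1) * \sum_(0 <= j < #|P|./2.+1)
      c ^+ (n - 2 * j) * (qeta ((-1) ^+ j : F)
      * esym_at P (fun i => qeta (a i)) (2 * j) * q%:R ^+ j).
Proof.
move=> unitsD; have d_gt0 i : (0 < d i)%N by rewrite gcdn_gt0 m_gt0.
rewrite -coef0_prod_norm_gauss_elt; last exact: odd_card_even_gcd.
rewrite diag_zeros_gcd_card // (diag_zeros_pairwise_coprime _ _ _ mem_P) //.
rewrite -coef0_prod_power_elt; congr (_ * _); congr (fun_of_fin _ 0).
apply: eq_bigr => i _; case: ifP => [/odd_card_even_gcd odd_q|_].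
  by rewrite power_elt2.
by rewrite power_elt1 // mul0r addr0.
Qed.

Lemma diag_zeros_units :
  q%:R * (diag_zeros (predC1 (0 : F)) a m)%:R
  = (q%:R - 1) ^+ n + (q%:R - 1) * (-1) ^+ n * (1 + eta_esym_sum).
Proof.
rewrite (@diag_zeros_esym_at (predC1 0)) // inE eqxx /= -mulrA.
congr (_ + _ * _).
rewrite big_ltn // muln0 subn0 esym_at0 expr0 qeta1 !mulr1 mulrDr mulr1.
congr (_ + _); rewrite mulr_sumr; apply: eq_big_nat => j /andP[_ jP].
have jn : (2 * j <= n)%N by move: jP (max_card_ord P); lia.
by rewrite -(signr_odd _ (n - _)) oddB // mul2n odd_double addbF signr_odd.
Qed.

Hypothesis n_gt0 : (0 < n)%N.

Lemma diag_zeros_predT :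
  (diag_zeros predT a m)%:R = q%:R ^+ n.-1 + full_even_term.
Proof.
have q0 : q%:R != 0 :> int by rewrite pnatr_eq0 -lt0n card_finField_gt0.
apply: (mulfI q0); rewrite (@diag_zeros_esym_at predT) // oppr0 addr0.
rewrite mulrDr -exprS prednK //; congr (_ + _).
case: ifPn => [/andP[/eqP Pn even_n]|not_full]; last first.
  rewrite mulr0 big_nat big1 ?mulr0 // => j jP.
  rewrite expr0n gtn_eqF ?mul0r // subn_gt0.
  move: not_full; rewrite negb_and negbK neq_ltn => not_full.
  by move: not_full jP (max_card_ord P); lia.
rewrite Pn big_nat_recr //= big_nat big1 => [|j jn]; last first.
  by rewrite expr0n gtn_eqF ?mul0r // subn_gt0; move: jn; lia.
have [i iP] : exists i, i \in P by apply/card_gt0P; rewrite Pn.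
have odd_q := odd_card_even_gcd iP.
rewrite mul2n even_halfK // subnn esym_at_full // qetaM // qeta_prod //.
have -> : n./2 = (n - 2)./2.+1 by move: n_gt0 even_n; lia.
by rewrite [_%:R ^+ _.+1]exprS; ring.
Qed.

Lemma card_solutions (b : F) (w kk : 'I_n -> nat) (k M : nat) :
  b != 0 -> (0 < k)%N -> (forall i, 0 < kk i)%N ->
  (forall i, w i * m i = M)%N ->
  gcdz ((\sum_i kk i * w i)%N%:Z - (k * M)%N%:Z) q.-1 = 1 ->
  #|[set x | solution a b m kk k x]|%:R
  = q%:R ^+ n.-1 + (-1) ^+ n.-1 * (1 + eta_esym_sum) + full_even_term.
Proof.
move=> b_neq0 k_gt0 kk_gt0 wm cop; set T := \sum_(1 <= j < _) _.
set E := (if _ then _ else _); pose q1 : int := q%:R - 1.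
have q1_neq0 : q1 != 0.
  rewrite /q1 -natr_card_finField_pred pnatr_eq0 -lt0n.
  exact: card_finField_pred_gt0.
have := card_solutions_diag_zeros a k_gt0 kk_gt0 b_neq0 wm cop.
move=> /(congr1 (fun N => N%:R : int)).
rewrite !natrD !natrM natrX !natr_card_finField_pred.
rewrite diag_zeros_units diag_zeros_predT -/q1 -/T -/E => solE.
have signE : (-1) ^+ n = - (-1) ^+ n.-1 :> int.
  by rewrite -[in LHS](prednK n_gt0) exprS mulN1r.
apply: (mulfI q1_neq0); apply: (addIr (q1 ^+ n + q1 * (-1) ^+ n * (1 + T))).
by rewrite solE signE; ring.
Qed.

End PairwiseCoprimeExponents.

Theorem theorem4 (F : finFieldType) (n : nat) (a : 'I_n -> F) (b : F)
    (m kk : 'I_n -> nat) (k t : nat) :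
  (2 <= n)%N ->
  (forall j, a j != 0) -> b != 0 ->
  (forall j, 0 < m j)%N -> (0 < k)%N -> (forall j, 0 < kk j)%N ->
  let q := #|F| in
  let M := \big[lcmn/1%N]_(j < n) m j in
  let d := fun j : 'I_n => gcdn (m j) q.-1 in
  (t <= n)%N ->
  (forall j : 'I_n, (j < t)%N -> odd (d j)) ->
  (forall j : 'I_n, (t <= j)%N -> ~~ odd (d j)) ->
  (forall i j : 'I_n, i != j ->
     coprime (if (i < t)%N then d i else (d i)./2)
             (if (j < t)%N then d j else (d j)./2)) ->
  gcdz (\sum_(j < n) ((kk j * (M %/ m j))%N)%:Z - ((k * M)%N)%:Z) (q.-1)%:Z = 1 ->
  (#|[set x : {ffun 'I_n -> F} |
        (\sum_(j < n) a j * x j ^+ m j) ^+ k == b * \prod_(j < n) x j ^+ kk j]|%:Z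
   = (q%:Z) ^+ n.-1 + (-1) ^+ n.-1
     + (-1) ^+ n.-1 *
       \sum_(1 <= j < ((n - t)./2).+1)
          qeta ((-1) ^+ j : F)
          * esym_at [pred i : 'I_n | (t <= i)%N] (fun i => qeta (a i)) (2 * j)
          * (q%:Z) ^+ j
     + (if (t == 0%N) && ~~ odd n then
          qeta ((-1) ^+ (n./2) * \prod_(j < n) a j) * (q%:Z) ^+ (n - 2)./2 * (q%:Z - 1)
        else 0)).
Proof.
move=> n_gt1 a_neq0 b_neq0 m_gt0 k_gt0 kk_gt0 q M d le_tn odd_d even_d cop_d.
rewrite -(big_morph Posz PoszD (erefl _)) => cop_weight.
pose P := [pred i : 'I_n | (t <= i)%N].
have mem_P i : (i \in P) = ~~ odd (d i).
  by rewrite inE; case: ltnP => [/odd_d -> | /even_d ->].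
have cop_P i j : i != j -> coprime (if i \in P then (d i)./2 else d i)
                                   (if j \in P then (d j)./2 else d j).
  by move=> /cop_d; rewrite !inE !ltnNge !if_neg.
have divMK j : (M %/ m j * m j)%N = M by rewrite divnK // (biglcmn_sup j).
have := card_solutions a_neq0 m_gt0 mem_P cop_P (ltnW n_gt1) b_neq0 k_gt0 kk_gt0
  divMK cop_weight.
rewrite card_ord_geq; have -> : (n - t == n)%N = (t == 0%N).
  by move: n_gt1 le_tn; lia.
by rewrite !natz mulrDr mulr1 addrA.
Qed.
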